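(* Let $n\ge 2$ and let $T$ be an invertible affine transformation of $\mathbb Z_2^n$, $Tv=Av+v_0$, with linear part $A$ and $v_0\in\mathbb Z_2^n$. Then $$QC_L(A)\ \le\ QC(T)\ \le\ QC_L(A)+QC(\tau_{v_0}),$$ where $\tau_{v_0}$ is the translation by $v_0$.
   Context: $\mathbb Z_2$ is the field with two elements. Local logic gate: let $\sigma$ be any permutation of the four-element set $\mathbb Z_2^2$ and let $1\le i<j\le n$. The induced permutation $\sigma_{i,j}$ of $\mathbb Z_2^n$ replaces the coordinates $(c_i,c_j)$ of a vector $(c_1,\dots,c_n)$ by the first and second components of $\sigma(c_i,c_j)$ respectively, and leaves all other coordinates unchanged. The permutations $\sigma_{i,j}$ are called local logic gates; a linear local logic gate is a local logic gate that is a linear map (i.e. $\sigma\in \mathrm{GL}(2,\mathbb Z_2)$). For an invertible affine transformation $T$ of $\mathbb Z_2^n$, the quantum complexity $QC(T)$ is the minimum number of local logic gates whose composition is $T$. For an invertible linear transformation $A$ of $\mathbb Z_2^n$, the linear quantum complexity $QC_L(A)$ is the minimum number of linear local logic gates whose composition is $A$. The empty composition is the identity. *)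

(* Defs.v *)
From mathcomp Require Import all_boot all_order all_algebra all_fingroup.

Set Implicit Arguments.
Unset Strict Implicit.
Unset Printing Implicit Defensive.

Import GRing.Theory.
Local Open Scope ring_scope.

Definition gate_fun (n : nat) (sigma : {perm 'F_2 * 'F_2}) (i j : 'I_n)
    (c : 'cV['F_2]_n) : 'cV['F_2]_n :=
  \col_k (if k == i then (sigma (c i 0, c j 0)).1
          else if k == j then (sigma (c i 0, c j 0)).2
          else c k 0).

Definition local_gates (n : nat) : {set {perm 'cV['F_2]_n}} :=
  [set g : {perm 'cV['F_2]_n} |
     [exists sigma : {perm 'F_2 * 'F_2}, exists i : 'I_n, exists j : 'I_n,
        (i < j)%N && [forall c : 'cV['F_2]_n, g c == gate_fun sigma i j c]]].

Definition linear_local_gates (n : nat) : {set {perm 'cV['F_2]_n}} :=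
  [set g : {perm 'cV['F_2]_n} in local_gates n |
     [forall a : 'F_2, forall u : 'cV['F_2]_n, forall v : 'cV['F_2]_n,
        g (a *: u + v) == a *: g u + g v]].

(* The product s * t of permutations is "s first, then t"; a product over the
   empty tuple is the identity. *)
Definition composable (gT : finGroupType) (G : {set gT}) (x : gT) (m : nat) : bool :=
  [exists s : m.-tuple gT, all (mem G) s && (x == \prod_(g <- s) g)%g].

Lemma gen_composable (gT : finGroupType) (G : {set gT}) (x : gT) :
  x \in <<G>>%g -> exists m, composable G x m.
Proof.
case/gen_prodgP => m [c cG ->]; exists m.
apply/existsP; exists [tuple c i | i < m]; apply/andP; split.
  by apply/allP => _ /mapP[i _ ->]; apply: cG.
by rewrite big_tuple; apply/eqP/eq_bigr => i _; rewrite tnth_mktuple.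
Qed.

(* The default value 0 is only taken outside the subgroup generated by G, where
   no composition exists: see QC_minimum and QC_L_minimum below. *)
Definition min_composition (gT : finGroupType) (G : {set gT}) (x : gT) : nat :=
  if @idP (x \in <<G>>%g) is ReflectT xG then ex_minn (gen_composable xG) else 0%N.

Definition QC (n : nat) (T : {perm 'cV['F_2]_n}) : nat :=
  min_composition (local_gates n) T.

Definition QC_L (n : nat) (L : {perm 'cV['F_2]_n}) : nat :=
  min_composition (linear_local_gates n) L.

Definition linear_perm (n : nat) (A : 'M['F_2]_n) (uA : A \in unitmx) :
    {perm 'cV['F_2]_n} :=
  perm (can_inj (mulKmx uA)).

Definition translation (n : nat) (v0 : 'cV['F_2]_n) : {perm 'cV['F_2]_n} :=
  perm (addIr v0).

Lemma min_compositionP (gT : finGroupType) (G : {set gT}) (x : gT) :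
  x \in <<G>>%g ->
  composable G x (min_composition G x) /\
  (forall m, composable G x m -> (min_composition G x <= m)%N).
Proof.
rewrite /min_composition; case: {-}_ / idP => // xG _.
by case: ex_minnP.
Qed.

Lemma F2P (x : 'F_2) : x = 0 \/ x = 1.
Proof. by case: x => [[|[|//]] ?]; [left | right]; apply: val_inj. Qed.

Lemma F2_addxx (x : 'F_2) : x + x = 0.
Proof. by case: (F2P x) => ->; apply: val_inj. Qed.

Lemma cV2_addxx (n : nat) (v : 'cV['F_2]_n) : v + v = 0.
Proof. by apply/colP => i; rewrite !mxE F2_addxx. Qed.

Lemma gate_fun_inj (n : nat) (sigma : {perm 'F_2 * 'F_2}) (i j : 'I_n) :
  i != j -> injective (gate_fun sigma i j).
Proof.
move=> ij c d /colP eq_cd.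
have /perm_inj[ei ej] : sigma (c i 0, c j 0) = sigma (d i 0, d j 0).
  have := eq_cd j; have := eq_cd i.
  rewrite !mxE !eqxx (negPf (_ : j != i)) 1?eq_sym //.
  by case: (sigma _) => ? ?; case: (sigma _) => ? ? /= -> ->.
apply/colP => k; case: (eqVneq k i) => [->|ki] //; case: (eqVneq k j) => [->|kj] //.
by have := eq_cd k; rewrite !mxE (negPf ki) (negPf kj).
Qed.

Lemma local_gate_mem (n : nat) (sigma : {perm 'F_2 * 'F_2}) (i j : 'I_n) :
  (i < j)%N ->
  exists2 g, g \in local_gates n & forall c, g c = gate_fun sigma i j c.
Proof.
move=> ij; have nij : i != j by rewrite -val_eqE neq_ltn ij.
exists (perm (gate_fun_inj (sigma := sigma) nij)) => [|c]; last by rewrite permE.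
rewrite inE; apply/existsP; exists sigma; apply/existsP; exists i.
by apply/existsP; exists j; rewrite ij; apply/forallP => c; rewrite permE.
Qed.

Lemma linear_local_gateP (n : nat) (g : {perm 'cV['F_2]_n}) :
  g \in local_gates n -> (forall a u v, g (a *: u + v) = a *: g u + g v) ->
  g \in linear_local_gates n.
Proof.
move=> gG lin; rewrite inE gG; apply/forallP => a.
by apply/forallP => u; apply/forallP => v; rewrite lin.
Qed.

Lemma add_to_fst_inj : injective (fun p : 'F_2 * 'F_2 => (p.1 + p.2, p.2)).
Proof. by move=> [a b] [c d] /eqP; rewrite xpair_eqE /= => /andP[/eqP e /eqP eb]; move: e; rewrite eb => /addIr ->. Qed.

Lemma add_to_snd_inj : injective (fun p : 'F_2 * 'F_2 => (p.1, p.1 + p.2)).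
Proof. by move=> [a b] [c d] /eqP; rewrite xpair_eqE /= => /andP[/eqP-> /eqP/addrI->]. Qed.

Lemma flip_fst_inj : injective (fun p : 'F_2 * 'F_2 => (p.1 + 1, p.2)).
Proof. by move=> [a b] [c d] /eqP; rewrite xpair_eqE /= => /andP[/eqP e /eqP eb]; move: e; rewrite eb => /addIr ->. Qed.

Lemma flip_snd_inj : injective (fun p : 'F_2 * 'F_2 => (p.1, p.2 + 1)).
Proof. by move=> [a b] [c d] /eqP; rewrite xpair_eqE /= => /andP[/eqP-> /eqP/addIr->]. Qed.

Lemma elementary_gate (n : nat) (i k : 'I_n) : i != k ->
  exists2 g, g \in linear_local_gates n &
    forall c : 'cV['F_2]_n, g c = c + c k 0 *: delta_mx i 0.
Proof.
move=> ik; have ki : k != i by rewrite eq_sym.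
have [g gG gE] : exists2 g, g \in local_gates n &
    forall c : 'cV['F_2]_n, g c = c + c k 0 *: delta_mx i 0.
  case: (ltngtP i k) => [lik|lki|/val_inj eik]; last by rewrite eik eqxx in ik.
    have [g gG gE] := local_gate_mem (perm add_to_fst_inj) lik.
    exists g => // c; rewrite gE; apply/colP => l; rewrite !mxE permE /= eqxx andbT.
    case: (eqVneq l i) => [->|li]; first by rewrite mulr1.
    by rewrite mulr0 addr0; case: eqP => [->|].
  have [g gG gE] := local_gate_mem (perm add_to_snd_inj) lki.
  exists g => // c; rewrite gE; apply/colP => l; rewrite !mxE permE /= eqxx andbT.
  case: (eqVneq l k) => [->|lk]; first by rewrite (negPf ki) mulr0 addr0.
  by case: eqP => [->|_]; rewrite ?mulr1 ?mulr0 ?addr0 // addrC.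
exists g => //; apply: linear_local_gateP => // a u v; rewrite !gE !mxE.
by rewrite scalerDr scalerDl scalerA addrACA.
Qed.

Lemma transvection_gen (n : nat) (k : 'I_n) (w : 'cV['F_2]_n) : w k 0 = 0 ->
  exists2 h, h \in <<linear_local_gates n>>%g & forall c, h c = c + c k 0 *: w.
Proof.
move=> wk; have -> : w = \sum_(i | i != k) w i 0 *: delta_mx i 0.
  apply/colP => l; rewrite summxE.
  case: (eqVneq l k) => [->|lk].
    by rewrite big1 ?wk // => i ik; rewrite !mxE eq_sym (negPf ik) mulr0.
  rewrite (bigD1 l) //= !mxE !eqxx mulr1 big1 ?addr0 // => i /andP[_ il].
  by rewrite !mxE eq_sym (negPf il) mulr0.
pose Q (u : 'cV['F_2]_n) := u k 0 = 0 /\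
  exists2 h, h \in <<linear_local_gates n>>%g & forall c, h c = c + c k 0 *: u.
suff [] : Q (\sum_(i | i != k) w i 0 *: delta_mx i 0) by [].
have Q0 : Q 0.
  by split; [rewrite mxE | exists 1%g => // c; rewrite perm1 scaler0 addr0].
apply: big_ind => // [u v [uk [g gG gE]] [vk [h hG hE]] | i ik].
  split; first by rewrite mxE uk vk addr0.
  exists (g * h)%g => [|c]; first exact: groupM.
  by rewrite permM gE hE !mxE uk mulr0 addr0 scalerDr addrA.
case: (F2P (w i 0)) => ->; first by rewrite scale0r.
rewrite scale1r; split; first by rewrite mxE eq_sym (negPf ik).
by have [g gG gE] := elementary_gate ik; exists g => //; apply: mem_gen.
Qed.

Definition basis_vec (n : nat) (i : 'I_n) : 'cV['F_2]_n := delta_mx i 0.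

Lemma cV_basis (n : nat) (v : 'cV['F_2]_n) : v = \sum_i v i 0 *: basis_vec i.
Proof.
apply/colP => l; rewrite summxE (bigD1 l) //= !mxE !eqxx mulr1 big1 ?addr0 // => i il.
by rewrite !mxE eq_sym (negPf il) mulr0.
Qed.

Lemma gauss_step (n : nat) (A : 'M['F_2]_n) (k : 'I_n) : A \in unitmx ->
  (forall i : 'I_n, (i < k)%N -> A *m basis_vec i = basis_vec i) ->
  exists2 h, h \in <<linear_local_gates n>>%g &
    forall i : 'I_n, (i <= k)%N -> h (A *m basis_vec i) = basis_vec i.
Proof.
move=> uA fixA; pose u := A *m basis_vec k.
have [i ki ui] : exists2 i : 'I_n, (k <= i)%N & u i 0 = 1.
  case: (boolP [exists i : 'I_n, (k <= i)%N && (u i 0 == 1)]).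
    by case/existsP => i /andP[? /eqP ?]; exists i.
  rewrite negb_exists => /forallP nu; exfalso.
  have u0 (i : 'I_n) : (k <= i)%N -> u i 0 = 0.
    by move=> ki; have := nu i; rewrite ki /=; case: (F2P (u i 0)) => ->.
  have Auu : A *m u = u.
    rewrite {1 2}[u]cV_basis mulmx_sumr; apply: eq_bigr => i _.
    rewrite -scalemxAr; case: (ltnP i k) => [/fixA -> //|/u0 ->].
    by rewrite !scale0r.
  have : u = basis_vec k by apply: (can_inj (mulKmx uA)).
  by move=> /colP /(_ k); rewrite u0 // !mxE !eqxx.
have uE : A *m basis_vec k = u by [].
clearbody u; have dlt (l j : 'I_n) : (j < l)%N -> (basis_vec j) l 0 = 0.
  by move=> jl; rewrite mxE eqxx andbT -val_eqE /= gtn_eqF.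
have [h1 h1G [h1u h1f]] : exists2 h1, h1 \in <<linear_local_gates n>>%g &
    h1 u k 0 = 1 /\
    forall j : 'I_n, (j < k)%N -> h1 (basis_vec j) = basis_vec j.
  case: (F2P (u k 0)) => uk; last first.
    by exists 1%g => //; split=> [|j _]; rewrite perm1.
  have nki : k != i by apply/eqP => e; move: ui; rewrite -e uk.
  have [g gG gE] := elementary_gate nki; exists g; first exact: mem_gen.
  split=> [|j jk]; first by rewrite gE !mxE uk ui !eqxx mulr1 add0r.
  by rewrite gE dlt ?(leq_trans jk) // scale0r addr0.
have wk : (h1 u + basis_vec k) k 0 = 0.
  by rewrite mxE h1u mxE !eqxx F2_addxx.
have [h2 h2G h2E] := transvection_gen wk.
exists (h1 * h2)%g => [|j]; first exact: groupM.
rewrite leq_eqVlt permM => /predU1P[/val_inj ->|jk].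
  by rewrite uE h2E h1u scale1r addrA cV2_addxx add0r.
by rewrite fixA // h1f // h2E dlt // scale0r addr0.
Qed.

Lemma gen_linear (n : nat) (h : {perm 'cV['F_2]_n}) :
  h \in <<linear_local_gates n>>%g -> exists B : 'M_n, forall v, h v = B *m v.
Proof.
case/gen_prodgP => m [c cG ->].
apply: (big_ind (fun h : {perm _} => exists B : 'M['F_2]_n, forall v, h v = B *m v)).
- by exists 1%:M => v; rewrite perm1 mul1mx.
- move=> g h' [B gE] [C hE]; exists (C *m B) => v.
  by rewrite permM gE hE mulmxA.
move=> i _; have := cG i; rewrite inE => /andP[_ /forallP lin].
have {}lin a u v : c i (a *: u + v) = a *: c i u + c i v.
  by move: (lin a) => /forallP/(_ u)/forallP/(_ v)/eqP.
have c0 : c i 0 = 0.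
  by have := lin 1 0 0; rewrite !scale1r addr0 => /(canLR (addrK _)); rewrite subrr.
exists (\matrix_(p, q) (c i (basis_vec q)) p 0) => v.
have -> : c i v = \sum_q v q 0 *: c i (basis_vec q).
  rewrite {1}[v]cV_basis.
  by elim/big_rec2: _ => // q x y _ <-; rewrite lin.
apply/colP => p; rewrite summxE !mxE; apply: eq_bigr => q _.
by rewrite !mxE mulrC.
Qed.

Lemma perm_unitmx (n : nat) (h : {perm 'cV['F_2]_n}) (B : 'M_n) :
  (forall v, h v = B *m v) -> B \in unitmx.
Proof.
move=> hE; pose C := \matrix_(p, q) ((h^-1)%g (basis_vec q)) p 0 : 'M['F_2]_n.
have BC : B *m C = 1%:M.
  apply/row_matrixP => p; apply/rowP => q; rewrite !mxE.
  have : B *m (h^-1)%g (basis_vec q) = basis_vec q by rewrite -hE permKV.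
  move=> /colP/(_ p); rewrite !mxE eqxx andbT => <-.
  by apply: eq_bigr => r _; rewrite !mxE.
by case/mulmx1_unit: BC.
Qed.

Lemma linear_perm_gen (n : nat) (A : 'M['F_2]_n) (uA : A \in unitmx) :
  linear_perm uA \in <<linear_local_gates n>>%g.
Proof.
have main m : (m <= n)%N -> exists2 h, h \in <<linear_local_gates n>>%g &
    forall i : 'I_n, (i < m)%N -> h (A *m basis_vec i) = basis_vec i.
  elim: m => [|m IH] lemn; first by exists 1%g.
  have [h hG hE] := IH (ltnW lemn); have [B BE] := gen_linear hG.
  have uB := perm_unitmx BE.
  have uBA : B *m A \in unitmx by rewrite unitmx_mul uB.
  have [|h' h'G h'E] := @gauss_step n (B *m A) (Ordinal lemn) uBA.
    by move=> i im; rewrite -mulmxA -BE hE.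
  exists (h * h')%g => [|i im]; first exact: groupM.
  by rewrite permM BE mulmxA h'E.
have [h hG hE] := main n (leqnn n); have [B BE] := gen_linear hG.
suff -> : linear_perm uA = (h^-1)%g by rewrite groupV.
apply/permP => v; apply: (@perm_inj _ h); rewrite permKV permE BE mulmxA.
rewrite {1}[v]cV_basis mulmx_sumr {2}[v]cV_basis; apply: eq_bigr => i _.
by rewrite -scalemxAr -mulmxA -BE hE.
Qed.

Lemma translation_gen (n : nat) (v0 : 'cV['F_2]_n) : (1 < n)%N ->
  translation v0 \in <<local_gates n>>%g.
Proof.
move=> n1; pose Q (w : 'cV['F_2]_n) := translation w \in <<local_gates n>>%g.
have QD u v : Q u -> Q v -> Q (u + v).
  rewrite /Q => Qu Qv.
  have -> : translation (u + v) = (translation u * translation v)%g.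
    by apply/permP => x; rewrite permM !permE addrA.
  exact: groupM.
have Q0 : Q 0.
  rewrite /Q (_ : translation 0 = 1%g) //.
  by apply/permP => x; rewrite perm1 permE addr0.
rewrite -/(Q v0) [v0]cV_basis; apply: (big_ind Q) => // i _.
case: (F2P (v0 i 0)) => ->; first by rewrite scale0r.
rewrite scale1r; apply: mem_gen.
have [j ij] : exists j : 'I_n, i != j.
  have n0 := ltnW n1.
  case: (eqVneq i (Ordinal n0)) => [->|]; last by exists (Ordinal n0).
  by exists (Ordinal n1).
have ji : j != i by rewrite eq_sym.
case: (ltngtP i j) => [lij|lji|/val_inj e]; last by rewrite e eqxx in ij.
  have [g gG gE] := local_gate_mem (perm flip_fst_inj) lij.
  rewrite (_ : translation _ = g) //; apply/permP => c.
  rewrite gE permE; apply/colP => l; rewrite !mxE permE /= eqxx andbT.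
  by case: (eqVneq l i) => [->|li] //; rewrite addr0; case: eqP => [->|].
have [g gG gE] := local_gate_mem (perm flip_snd_inj) lji.
rewrite (_ : translation _ = g) //; apply/permP => c.
rewrite gE permE; apply/colP => l; rewrite !mxE permE /= eqxx andbT.
case: (eqVneq l j) => [->|lj]; first by rewrite (negPf ji) addr0.
by case: (eqVneq l i) => [->|li] //; rewrite addr0.
Qed.

Lemma affine_gen (n : nat) (A : 'M['F_2]_n) (v0 : 'cV['F_2]_n)
    (T : {perm 'cV['F_2]_n}) :
  (1 < n)%N -> (forall v, T v = A *m v + v0) -> T \in <<local_gates n>>%g.
Proof.
move=> n1 TE.
have LE v : (T * translation v0)%g v = A *m v.
  by rewrite permM TE permE -addrA cV2_addxx addr0.
have uA := perm_unitmx LE.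
have -> : T = (linear_perm uA * translation v0)%g.
  by apply/permP => v; rewrite permM !permE TE.
apply: groupM; last exact: translation_gen.
apply: subsetP (linear_perm_gen uA); apply: genS.
by apply/subsetP => g; rewrite inE => /andP[].
Qed.

Lemma QC_minimum (n : nat) (A : 'M['F_2]_n) (v0 : 'cV['F_2]_n)
    (T : {perm 'cV['F_2]_n}) :
  (1 < n)%N -> (forall v, T v = A *m v + v0) ->
  composable (local_gates n) T (QC T) /\
  (forall m, composable (local_gates n) T m -> (QC T <= m)%N).
Proof. by move=> n1 TE; apply/min_compositionP/(affine_gen n1 TE). Qed.

Lemma QC_L_minimum (n : nat) (A : 'M['F_2]_n) (uA : A \in unitmx) :
  composable (linear_local_gates n) (linear_perm uA) (QC_L (linear_perm uA)) /\
  (forall m, composable (linear_local_gates n) (linear_perm uA) m ->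
     (QC_L (linear_perm uA) <= m)%N).
Proof. exact/min_compositionP/linear_perm_gen. Qed.

(* Main.v *)
(** Every permutation of the plane [F_2^2] is affine, because its four values sum
    to the sum of all points, which is 0. Hence every local gate [g] is affine and
    its linear part [c |-> g c + g 0] is again a local gate. Taking linear parts
    is multiplicative on affine maps, so a circuit for [T] yields a linear
    circuit of the same length for [A]; the upper bound concatenates a linear
    circuit for [A] with a circuit for the translation. *)
Require Import Defs.
From mathcomp Require Import all_boot all_order all_algebra all_fingroup.

Local Open Scope ring_scope.

Import GRing.Theory.

(** Sequences in place of tuples let circuits be concatenated and mapped without length casts. *)
Lemma composableP (gT : finGroupType) (G : {set gT}) (x : gT) (m : nat) :
  reflect (exists s : seq gT,
             [/\ size s = m, {subset s <= G} & x = (\prod_(g <- s) g)%g])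
          (composable G x m).
Proof.
apply: (iffP existsP) => [[s /andP[/allP sG /eqP ->]]|[s [sm sG ->]]].
  by exists s; rewrite size_tuple.
exists (tcast sm (in_tuple s)).
by rewrite val_tcast eqxx andbT; apply/allP.
Qed.

Lemma composableM (gT : finGroupType) (G : {set gT}) (x y : gT) (m k : nat) :
  composable G x m -> composable G y k -> composable G (x * y)%g (m + k).
Proof.
move=> /composableP[s [<- sG ->]] /composableP[t [<- tG ->]].
apply/composableP; exists (s ++ t); rewrite size_cat big_cat; split=> // g.
by rewrite mem_cat => /orP[/sG|/tG].
Qed.

Lemma composableS (gT : finGroupType) (G H : {set gT}) (x : gT) (m : nat) :
  G \subset H -> composable G x m -> composable H x m.
Proof.
move=> /subsetP GH /composableP[s [sm sG ->]].
by apply/composableP; exists s; split=> // g /sG/GH.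
Qed.

Lemma F2_plane_addxx (p : 'F_2 * 'F_2) : p + p = 0.
Proof. by case: p => a b; apply/eqP; rewrite xpair_eqE /= !F2_addxx. Qed.

Lemma sum_F2_plane : \sum_(p : 'F_2 * 'F_2) p = 0.
Proof.
have -> : \sum_(p : 'F_2 * 'F_2) p = \sum_a \sum_b (a, b).
  by rewrite pair_bigA; apply: eq_bigr => -[].
by rewrite !big_ord_recl !big_ord0; apply/eqP.
Qed.

(** Distinct nonzero vectors of the plane form a basis, and a basis has only four combinations over
    ['F_2]. *)
Lemma F2_plane_cover (p q x : 'F_2 * 'F_2) : p != 0 -> q != 0 -> p != q ->
  [|| x == 0, x == p, x == q | x == p + q].
Proof.
case: p q x => [a b] [c d] [e f].
by case: (F2P a) => ->; case: (F2P b) => ->; case: (F2P c) => ->;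
   case: (F2P d) => ->; case: (F2P e) => ->; case: (F2P f) => ->.
Qed.

Lemma perm_F2_plane_affine (sigma : {perm 'F_2 * 'F_2}) (p q : 'F_2 * 'F_2) :
  sigma (p + q) = sigma p + sigma q + sigma 0.
Proof.
have [->|p0] := eqVneq p 0; first by rewrite add0r addrAC F2_plane_addxx add0r.
have [->|q0] := eqVneq q 0; first by rewrite addr0 -addrA F2_plane_addxx addr0.
have [->|pq] := eqVneq p q; first by rewrite !F2_plane_addxx add0r.
(* In the generic case 0, [p], [q], [p + q] are all the points, so this sum has exactly the four
   terms of the claim. *)
have : \sum_x sigma x = 0.
  by rewrite -[RHS]sum_F2_plane [RHS](reindex_inj (@perm_inj _ sigma)).
have pqp : p != p + q by rewrite -subr_eq0 opprD addNKr oppr_eq0.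
have pqq : q != p + q by rewrite eq_sym -subr_eq0 addrK.
have pq0 : p + q != 0.
  by apply: contra pq => /eqP e; rewrite -(inj_eq (addIr q)) e F2_plane_addxx.
rewrite (bigD1 (p + q)) //= (bigD1 p) //= (bigD1 q) /=; last by rewrite pqq eq_sym.
rewrite (bigD1 (0 : 'F_2 * 'F_2)) /= ?big1 ?addr0; first last.
- by rewrite ![0 == _]eq_sym pq0 p0 q0.
- move=> x; have := F2_plane_cover p q x p0 q0 pq.
  by do 4![case: eqP => //=].
(* In characteristic 2, adding [sigma (p + q)] moves it to the other side. *)
move=> /(congr1 (fun y => sigma (p + q) + y)) /=.
by rewrite (addrA (sigma (p + q))) F2_plane_addxx add0r addr0 addrA.
Qed.

Lemma linear_part_subproof (n : nat) (g : {perm 'cV['F_2]_n}) :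
  injective (fun c => g c + g 0).
Proof. by move=> c d /addIr/perm_inj. Qed.

(* The linear part of [g] when [g] is affine: over 'F_2, subtracting [g 0] is
   adding it. *)
Definition linear_part (n : nat) (g : {perm 'cV['F_2]_n}) : {perm 'cV['F_2]_n} :=
  perm (@linear_part_subproof n g).

Lemma linear_partE (n : nat) (g : {perm 'cV['F_2]_n}) c :
  linear_part n g c = g c + g 0.
Proof. by rewrite permE. Qed.

Lemma local_gate_affine (n : nat) (g : {perm 'cV['F_2]_n}) u v :
  g \in local_gates n -> g (u + v) = g u + g v + g 0.
Proof.
rewrite inE => /existsP[sigma /existsP[i /existsP[j /andP[_ /forallP gE]]]].
rewrite !(eqP (gE _)); apply/colP => k; rewrite !mxE.
have -> : (u i 0 + v i 0, u j 0 + v j 0) = (u i 0, u j 0) + (v i 0, v j 0) by [].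
(* On the two active wires this is the plane identity; on any other wire [g 0] contributes 0. *)
rewrite perm_F2_plane_affine -[(0, 0)]/(0 : 'F_2 * 'F_2).
by do 2![case: eqP => // _]; rewrite addr0.
Qed.

Lemma linear_part_gate (n : nat) (g : {perm 'cV['F_2]_n}) :
  g \in local_gates n -> linear_part n g \in linear_local_gates n.
Proof.
move=> gG; apply: linear_local_gateP => [|a u v]; last first.
  rewrite !linear_partE local_gate_affine // -addrA cV2_addxx addr0.
  case: (F2P a) => ->; rewrite ?scale1r ?scale0r.
    by rewrite add0r addrC.
  by rewrite addrACA cV2_addxx addr0.
move: gG; rewrite inE => /existsP[sigma /existsP[i /existsP[j /andP[ij /forallP gE]]]].
(* The linear part acts on the same wires, through the linear part of [sigma]. *)
have sigma_inj : injective (fun p => sigma p + sigma 0) by move=> p q /addIr/perm_inj.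
rewrite inE; apply/existsP; exists (perm sigma_inj); apply/existsP; exists i.
apply/existsP; exists j; rewrite ij; apply/forallP => c; apply/eqP.
rewrite linear_partE !(eqP (gE _)); apply/colP => k; rewrite !mxE permE.
by do 2![case: eqP => // _]; rewrite addr0.
Qed.

(** Expanding [h (g c + g 0)] by affinity produces [h 0] a second time, and the two copies
    cancel. *)
Lemma linear_partM (n : nat) (g h : {perm 'cV['F_2]_n}) :
  (forall u v, h (u + v) = h u + h v + h 0) ->
  linear_part n (g * h)%g = (linear_part n g * linear_part n h)%g.
Proof.
move=> hA; apply/permP => c; rewrite permM !linear_partE hA !permM.
by rewrite -[RHS]addrA cV2_addxx addr0.
Qed.

Lemma linear_part_composable (n m : nat) (T : {perm 'cV['F_2]_n}) :
  composable (local_gates n) T m ->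
  composable (linear_local_gates n) (linear_part n T) m.
Proof.
move=> /composableP[s [<- sG ->]]; apply/composableP.
exists [seq linear_part n g | g <- s]; split; first by rewrite size_map.
  by move=> _ /mapP[g /sG gG ->]; apply: linear_part_gate.
(* Peeling off the last gate makes the outer factor in [linear_partM] a single gate, which is known
   to be affine. *)
rewrite big_map; elim/last_ind: s sG => [|s g IHs] sG.
  by rewrite !big_nil; apply/permP => c; rewrite linear_partE !perm1 addr0.
have gG : g \in local_gates n by apply: sG; rewrite mem_rcons mem_head.
rewrite -cats1 !big_cat !big_seq1 /= linear_partM; last by move=> u v; apply: local_gate_affine.
by rewrite IHs // => h hs; apply: sG; rewrite mem_rcons in_cons hs orbT.
Qed.

Theorem theorem5p3 (n : nat) (n_ge2 : (2 <= n)%N) (A : 'M['F_2]_n)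
    (uA : A \in unitmx) (v0 : 'cV['F_2]_n) (T : {perm 'cV['F_2]_n})
    (TE : forall v : 'cV['F_2]_n, T v = A *m v + v0) :
  (QC_L (linear_perm uA) <= QC T)%N /\
  (QC T <= QC_L (linear_perm uA) + QC (translation v0))%N.
Proof.
have [T_comp T_min] := QC_minimum n_ge2 TE.
have [A_comp A_min] := QC_L_minimum uA.
(* Viewed as an affine map, the translation has a circuit attaining its [QC], so the default value 0
   is excluded. *)
have tE v : translation v0 v = 1%:M *m v + v0 by rewrite permE mul1mx.
have [t_comp _] := QC_minimum n_ge2 tE.
split.
  (* Since [T 0 = v0], adding [T 0] removes the translation. *)
  apply: A_min; have -> : linear_perm uA = linear_part n T.
    apply/permP => v; rewrite linear_partE !TE permE mulmx0 add0r -addrA.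
    by rewrite cV2_addxx addr0.
  exact: linear_part_composable.
apply: T_min; have -> : T = (linear_perm uA * translation v0)%g.
  by apply/permP => v; rewrite permM !permE TE.
apply: composableM t_comp; apply: composableS A_comp.
by apply/subsetP => g; rewrite inE => /andP[].
Qed.
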